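(* Let $\mathbb{K}$ be an algebraically closed field. Let $X = \mathbb{P}^{n_1}\times\cdots\times\mathbb{P}^{n_\ell}\subset\mathbb{P}^r$, $r+1=(n_1+1)\cdots(n_\ell+1)$, be the Segre variety over $\mathbb{K}$ for some $\ell\ge 2$, where $n_1,\ldots,n_\ell\ge 1$. Then $$\text{rank-index}(X) = 4.$$ Furthermore, the homogeneous ideal $I(X)$ has no quadratic polynomials of rank $3$.
   Context: The rank of a quadratic form is the rank of its associated symmetric matrix. For a variety $X\subset\mathbb{P}^r$ whose homogeneous ideal $I(X)$ is generated by quadratic forms, $\text{rank-index}(X)$ is the smallest integer $k$ such that $I(X)$ can be generated by quadratic forms of rank at most $k$. *)

(* Defs.v *)
From HB Require Import structures.
From mathcomp Require Import all_boot all_order all_algebra.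
From mathcomp Require Export mpoly.

Set Implicit Arguments.
Unset Strict Implicit.
Unset Printing Implicit Defensive.

Import GRing.Theory.
Local Open Scope ring_scope.

Definition ideal_gen (A : comNzRingType) (S : A -> Prop) (p : A) : Prop :=
  exists (m : nat) (c g : 'I_m -> A),
    (forall i, S (g i)) /\ p = \sum_(i < m) c i * g i.

(* Quadratic forms in N variables. *)

(* The matrix of the bilinear form Q(x + y) - Q(x) - Q(y). *)
Definition polar_mx (K : fieldType) (N : nat) (Q : {mpoly K[N]}) : 'M[K]_N :=
  \matrix_(i, j) (Q@_(U_(i) + U_(j)) *+ (i == j).+1).

(* When 2 is invertible this is the unique symmetric matrix A with
   Q(x) = x^T A x, see symmetric_mx_form and symmetric_mx_uniq. In
   characteristic 2 such an A need not exist, and the symmetric matrix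
   associated with Q is that of its polar form. *)
Definition symmetric_mx (K : fieldType) (N : nat) (Q : {mpoly K[N]}) : 'M[K]_N :=
  if (2%:R : K) == 0 then polar_mx Q else 2%:R^-1 *: polar_mx Q.

Definition qf_rank (K : fieldType) (N : nat) (Q : {mpoly K[N]}) : nat :=
  \rank (symmetric_mx Q).

Lemma mdeg2P (N : nat) (m : 'X_{1..N}) :
  mdeg m = 2 -> exists i j, m = (U_(i) + U_(j))%MM.
Proof.
move=> m2.
have [i mi]: exists i, m i != 0%N.
  apply/existsP; apply: contraPT m2 => /existsPn m0.
  by rewrite mdegE big1 // => i _; apply/eqP; have := m0 i; rewrite negbK.
have Ule: (U_(i) <= m)%MM by rewrite lep1mP.
have: mdeg (m - U_(i))%MM == 1%N.
  by rewrite -(eqn_add2r (mdeg U_(i)%MM)) -mdegD submK // m2 mdeg1.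
case/mdeg1P => j /eqP mj; exists j, i.
by rewrite -mj submK.
Qed.

Lemma mnm2_eq (N : nat) (i j k l : 'I_N) :
  ((U_(k) + U_(l))%MM == (U_(i) + U_(j))%MM) =
  ((k == i) && (l == j)) || ((k == j) && (l == i)).
Proof.
apply/eqP/orP => [/mnmP e|]; last first.
  by case=> /andP[/eqP-> /eqP->] //; rewrite addmC.
have := e k; have := e l; have := e i; have := e j.
rewrite !mnmDE !mnm1E !eqxx (eq_sym j i) (eq_sym l k) !(eq_sym i) !(eq_sym j).
have [->|_] := eqVneq k i; have [->|_] := eqVneq l j => //=; try by left.
all: have [?|_] := eqVneq k j; have [?|_] := eqVneq l i => //=; try by right.
all: subst; rewrite ?eqxx //; by repeat case: eqVneq.
Qed.

Lemma mcoeff_form (K : fieldType) (N : nat) (A : 'M[K]_N) (i j : 'I_N) :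
  (\sum_k \sum_l A k l *: ('X_k * 'X_l : {mpoly K[N]}))@_(U_(i) + U_(j))
    = if i == j then A i i else A i j + A j i.
Proof.
have cX k l : (A k l *: ('X_k * 'X_l : {mpoly K[N]}))@_(U_(i) + U_(j)) =
    if ((k == i) && (l == j)) || ((k == j) && (l == i)) then A k l else 0.
  rewrite mcoeffZ -mpolyXD mcoeffX mnm2_eq.
  by case: ifP => _; rewrite ?mulr1 ?mulr0.
rewrite raddf_sum /=; under eq_bigr => k _ do
  (rewrite raddf_sum /=; under eq_bigr => l _ do rewrite cX).
rewrite (bigD1 i) //= (bigD1 j) //= !eqxx /= [X in _ + X + _]big1 ?addr0; last first.
  move=> l lj; rewrite (negPf lj) /=; case: ifP => // /andP[/eqP ij /eqP li].
  by rewrite li ij eqxx in lj.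
have [ij|ij] := eqVneq i j.
  rewrite ij big1 ?addr0 // => k kj; rewrite big1 // => l _.
  by rewrite -ij in kj *; rewrite (negPf kj).
rewrite (bigD1 j) 1?eq_sym //= (bigD1 i) //= !eqxx orbT big1 ?addr0; last first.
  by move=> l li; rewrite (negPf ij) (negPf li).
rewrite big1 ?addr0 // => k /andP[ki kj]; rewrite big1 // => l _.
by rewrite (negPf ki) (negPf kj).
Qed.

Lemma symmetric_mx_sym (K : fieldType) (N : nat) (Q : {mpoly K[N]}) :
  (symmetric_mx Q)^T = symmetric_mx Q.
Proof.
by apply/matrixP=> i j; rewrite /symmetric_mx; case: ifP => _;
  rewrite !mxE addmC eq_sym.
Qed.

Lemma symmetric_mx_form (K : fieldType) (N : nat) (Q : {mpoly K[N]}) :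
  (2%:R : K) != 0 -> Q \is 2.-homog ->
  Q = \sum_i \sum_j symmetric_mx Q i j *: ('X_i * 'X_j).
Proof.
move=> two Qh.
have Fh : \sum_i \sum_j symmetric_mx Q i j *: ('X_i * 'X_j) \is [in K[N], 2.-homog].
  apply: rpred_sum => i _; apply: rpred_sum => j _; apply: rpredZ.
  by rewrite -mpolyXD dhomogX /= mdegD !mdeg1.
apply/mpolyP => m; have [m2|m2] := eqVneq (mdeg m) 2; last first.
  by rewrite (dhomog_nemf_coeff Qh m2) (dhomog_nemf_coeff Fh m2).
have [i [j ->]] := mdeg2P m2; rewrite mcoeff_form /symmetric_mx (negPf two) !mxE.
rewrite (eq_sym j i) eqxx; have [<-|_] := eqVneq i j.
  by rewrite /= -[X in _ * X]mulr_natl mulKf.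
by rewrite /= !mulr1n (addmC U_(j)%MM) -mulrDr -mulr2n -[X in _ * X]mulr_natl
  mulKf.
Qed.

Lemma symmetric_mx_uniq (K : fieldType) (N : nat) (A : 'M[K]_N) :
  (2%:R : K) != 0 -> A^T = A ->
  symmetric_mx (\sum_i \sum_j A i j *: ('X_i * 'X_j : {mpoly K[N]})) = A.
Proof.
move=> two sA; apply/matrixP=> i j; rewrite /symmetric_mx (negPf two) !mxE.
rewrite mcoeff_form; have [<-|_] := eqVneq i j.
  by rewrite /= -[X in _ * X]mulr_natl mulKf.
by rewrite -{2}sA mxE /= mulr1n -mulr2n -[X in _ * X]mulr_natl mulKf.
Qed.

(* A subset of P^(N-1) is given by the set of the nonzero vectors of
   homogeneous coordinates of its points. *)

Definition homogeneous_ideal (K : fieldType) (N : nat) (X : 'rV[K]_N -> Prop) :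
    {mpoly K[N]} -> Prop :=
  ideal_gen (fun f => (exists d : nat, f \is d.-homog) /\
                      (forall x, X x -> f.@[x ord0] = 0)).

Definition generated_by_rank_le (K : fieldType) (N : nat)
    (I : {mpoly K[N]} -> Prop) (k : nat) : Prop :=
  exists S : {mpoly K[N]} -> Prop,
    (forall Q, S Q -> Q \is 2.-homog /\ (qf_rank Q <= k)%N) /\
    (forall p, I p <-> ideal_gen S p).

Definition is_rank_index (K : fieldType) (N : nat) (X : 'rV[K]_N -> Prop)
    (k : nat) : Prop :=
  generated_by_rank_le (homogeneous_ideal X) k /\
  (forall j, generated_by_rank_le (homogeneous_ideal X) j -> (k <= j)%N).

(* The homogeneous coordinates of the Segre variety are indexed by the tuples
   (a_1, ..., a_l) with 0 <= a_i <= n_i. *)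
Definition segre_index (l : nat) (n : 'I_l -> nat) : finType :=
  {dffun forall i : 'I_l, 'I_(n i).+1}.

Lemma card_segre_index (l : nat) (n : 'I_l -> nat) :
  #|segre_index n| = (\prod_(i < l) (n i).+1)%N.
Proof.
rewrite card_dep_ffun foldrE big_map /= -[RHS]big_enum /=.
by apply: eq_big_seq => i _; rewrite card_ord.
Qed.

Definition segre_map (K : fieldType) (l : nat) (n : 'I_l -> nat)
    (u : forall i : 'I_l, 'rV[K]_(n i).+1) : 'rV[K]_#|segre_index n| :=
  \row_k \prod_(i < l) u i ord0 ((enum_val k : segre_index n) i).

Definition segre (K : fieldType) (l : nat) (n : 'I_l -> nat)
    (x : 'rV[K]_#|segre_index n|) : Prop :=
  exists u : forall i : 'I_l, 'rV[K]_(n i).+1,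
    (forall i, u i != 0) /\ x = segre_map u.
Arguments segre K {l} n x.

(* Main.v *)
Require Import Defs.
From HB Require Import structures.
From mathcomp Require Import all_boot all_order all_algebra.
From mathcomp Require Import ring.

(* Let Q be a quadric through X of rank at most 3 and P its polar matrix.  By
   Frobenius' rank inequality every totally isotropic subspace of P has image
   of dimension at most 1 under P, so pP and qP are parallel whenever p and q
   are pure tensors that differ in one factor, the line through them lying on
   X.  Changing one factor at a time, pP and qP are parallel for all pure
   tensors p and q, hence P has rank at most 1; its diagonal vanishes because
   X contains the coordinate points, so P = 0 and then Q = 0.  This works in
   every characteristic.
   Conversely I(X) is generated by the binomials X_b X_c - X_b' X_c', where b'
   and c' arise from b and c by exchanging their i-th entries; these have rank
   at most 4.  Modulo them a monomial depends only on its multidegree, and the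
   coefficients of f in I(X) sum to 0 over each multidegree. *)

Set Implicit Arguments.
Unset Strict Implicit.
Unset Printing Implicit Defensive.

Import GRing.Theory.

(** * Ideals generated by a set *)

Section IdealGen.
Local Open Scope ring_scope.
Variable A : comNzRingType.
Implicit Types S T : A -> Prop.

Lemma ideal_gen_mem S p : S p -> ideal_gen S p.
Proof.
by move=> Sp; exists 1, (fun=> 1), (fun=> p); rewrite big_ord1 mul1r.
Qed.

Lemma ideal_gen0 S : ideal_gen S 0.
Proof. by exists 0, (fun=> 0), (fun=> 0); rewrite big_ord0; split=> [[]|]. Qed.

Lemma ideal_genD S p q : ideal_gen S p -> ideal_gen S q -> ideal_gen S (p + q).
Proof.
move=> [m1 [c1 [g1 [S1 ->]]]] [m2 [c2 [g2 [S2 ->]]]].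
pose glue (f1 : 'I_m1 -> A) (f2 : 'I_m2 -> A) i :=
  match split i with inl j => f1 j | inr j => f2 j end.
exists (m1 + m2)%N, (glue c1 c2), (glue g1 g2); split.
  by move=> i; rewrite /glue; case: split.
rewrite big_split_ord /glue; congr (_ + _); apply: eq_bigr => i _.
  by rewrite (unsplitK (inl i)).
by rewrite (unsplitK (inr i)).
Qed.

Lemma ideal_genMl S a p : ideal_gen S p -> ideal_gen S (a * p).
Proof.
move=> [m [c [g [Sg ->]]]]; exists m, (fun i => a * c i), g; split=> //.
by rewrite big_distrr; apply: eq_bigr => i _; rewrite /= mulrA.
Qed.

Lemma ideal_gen_sum S (I : eqType) (r : seq I) (F : I -> A) :
  (forall i, i \in r -> ideal_gen S (F i)) -> ideal_gen S (\sum_(i <- r) F i).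
Proof.
elim: r => [|i r IHr] SF; first by rewrite big_nil; apply: ideal_gen0.
rewrite big_cons; apply: ideal_genD; first by apply: SF; rewrite mem_head.
by apply: IHr => j jr; apply: SF; rewrite in_cons jr orbT.
Qed.

Lemma ideal_gen_sub S T p :
  (forall q, S q -> ideal_gen T q) -> ideal_gen S p -> ideal_gen T p.
Proof.
move=> ST [m [c [g [Sg ->]]]]; apply: ideal_gen_sum => i _.
by apply/ideal_genMl/ST.
Qed.

End IdealGen.

(** * Polar matrices of quadratic forms and totally isotropic pencils *)

Section PolarForm.
Local Open Scope ring_scope.
Variables (K : fieldType) (N : nat).
Implicit Types (Q : {mpoly K[N]}) (x y : 'rV[K]_N).

(** In both cases the symmetric matrix is a nonzero multiple of the polar one, so the characteristic
    of [K] needs no further case split. *)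
Lemma qf_rank_polar Q : qf_rank Q = \rank (polar_mx Q).
Proof.
rewrite /qf_rank /symmetric_mx; case: ifPn => // two.
by rewrite mxrank_scale_nz // invr_neq0.
Qed.

Lemma polar_mx_sym Q : (polar_mx Q)^T = polar_mx Q.
Proof. by apply/matrixP=> i j; rewrite !mxE addmC eq_sym. Qed.

(** A triangular Gram matrix exists in every characteristic, unlike a symmetric one. *)
Definition upper_mx Q : 'M[K]_N :=
  \matrix_(i, j) (Q@_(U_(i) + U_(j)) *+ (i <= j)%N).

Lemma upper_mx_form Q : Q \is 2.-homog ->
  Q = \sum_i \sum_j upper_mx Q i j *: ('X_i * 'X_j).
Proof.
move=> Qh.
have Fh : (\sum_i \sum_j upper_mx Q i j *: ('X_i * 'X_j) : {mpoly K[N]})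
    \is 2.-homog.
  apply: rpred_sum => i _; apply: rpred_sum => j _; apply: rpredZ.
  by rewrite -mpolyXD dhomogX /= mdegD !mdeg1.
apply/mpolyP => m; have [m2|m2] := eqVneq (mdeg m) 2%N; last first.
  by rewrite (dhomog_nemf_coeff Qh m2) (dhomog_nemf_coeff Fh m2).
have [i [j ->]] := mdeg2P m2; rewrite mcoeff_form !mxE leqnn.
have [<-//|ij] := eqVneq i j; rewrite (addmC U_(j)%MM) -mulrnDr.
by move: ij; rewrite -val_eqE /=; case: ltngtP.
Qed.

Lemma meval_upper Q (v : 'I_N -> K) : Q \is 2.-homog ->
  Q.@[v] = \sum_i \sum_j upper_mx Q i j * (v i * v j).
Proof.
move=> /upper_mx_form {1}->; rewrite raddf_sum; apply: eq_bigr => i _.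
rewrite /= raddf_sum; apply: eq_bigr => j _.
by rewrite /= mevalZ mevalM !mevalXU.
Qed.

Lemma polar_mx_upper Q : polar_mx Q = upper_mx Q + (upper_mx Q)^T.
Proof.
apply/matrixP=> i j; rewrite !mxE (addmC U_(j)%MM) -mulrnDr; congr (_ *+ _).
by rewrite -val_eqE /=; case: ltngtP.
Qed.

Lemma meval_polar Q x y : Q \is 2.-homog ->
  Q.@[(x + y) ord0] =
  Q.@[x ord0] + Q.@[y ord0] + (x *m polar_mx Q *m y^T) ord0 ord0.
Proof.
move=> Qh; rewrite !meval_upper // polar_mx_upper mulmxDr mulmxDl mxE.
have mE B : (x *m B *m y^T) ord0 ord0 =
    \sum_i \sum_j B i j * (x ord0 i * y ord0 j).
  rewrite mxE exchange_big; apply: eq_bigr => j _; rewrite !mxE big_distrl /=.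
  by apply: eq_bigr => i _; rewrite mulrAC mulrC.
rewrite !mE [X in _ = _ + (_ + X)]exchange_big /= -!big_split.
apply: eq_bigr => i _.
rewrite -!big_split; apply: eq_bigr => j _; rewrite !mxE /=.
ring.
Qed.

(** Vanishing of the 2 x 2 minors of the pair. The zero vector is parallel to everything, so
    transitivity needs a nonzero middle vector. *)
Definition parallel x y : Prop :=
  forall a b, x ord0 a * y ord0 b = x ord0 b * y ord0 a.

Lemma parallel_sym x y : parallel x y -> parallel y x.
Proof. by move=> xy a b; rewrite mulrC -xy mulrC. Qed.

Lemma parallel_trans y x z :
  y != 0 -> parallel x y -> parallel y z -> parallel x z.
Proof.
case/rV0Pn=> k yk xy yz a b; apply: (mulIf (mulf_neq0 yk yk)).
transitivity ((x ord0 a * y ord0 k) * (y ord0 k * z ord0 b)); first by ring.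
rewrite (xy a) (yz k b).
transitivity ((x ord0 k * y ord0 b) * (y ord0 a * z ord0 k)); first by ring.
rewrite -(xy b) -(yz k a); ring.
Qed.

Lemma rank_le1_parallel x y : (\rank (col_mx x y) <= 1)%N -> parallel x y.
Proof.
move=> r1 a b; have [->|x0] := eqVneq x 0; first by rewrite !mxE !mul0r.
suff /sub_rVP[c ->]: (y <= x)%MS by rewrite !mxE; ring.
have xM : (x <= col_mx x y)%MS by rewrite -addsmxE addsmxSl.
have yM : (y <= col_mx x y)%MS by rewrite -addsmxE addsmxSr.
apply: submx_trans yM _.
by rewrite -(mxrank_leqif_sup xM) eqn_leq mxrankS //= rank_rV x0.
Qed.

(** With [M] the rows [x], [y] and [P] the polar matrix, [M *m P *m M^T = 0]. Frobenius' inequality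
    and the symmetry of [P] give twice the rank of [M *m P] at most 3, so this rank is at most 1. *)
Lemma isotropic_pencil_parallel Q x y : Q \is 2.-homog ->
    (\rank (polar_mx Q) <= 3)%N ->
    (forall a b, Q.@[(a *: x + b *: y) ord0] = 0) ->
  parallel (x *m polar_mx Q) (y *m polar_mx Q).
Proof.
move=> Qh r3 Q0; apply: rank_le1_parallel.
set P := polar_mx Q; pose M := col_mx x y.
(* The sum of two vectors of the pencil lies in the pencil, so the three values of [Q] in the
   polarization identity vanish. *)
have iso a b c d :
    ((a *: x + b *: y) *m P *m (c *: x + d *: y)^T) ord0 ord0 = 0.
  have := meval_polar (a *: x + b *: y) (c *: x + d *: y) Qh.
  by rewrite addrACA -!scalerDl !Q0 !add0r.
have isoM : M *m P *m M^T = 0.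
  apply/matrixP=> i j; rewrite [RHS]mxE.
  have rM k : exists a b, row k M = a *: x + b *: y.
    rewrite -(splitK k); case: (split k) => k' /=.
      by exists 1, 0; rewrite rowKu row_id scale1r scale0r addr0.
    by exists 0, 1; rewrite rowKd row_id scale1r scale0r add0r.
  have [a [b ri]] := rM i; have [c [d rj]] := rM j.
  rewrite -(iso a b c d) -ri -rj -row_mul [LHS]mxE [RHS]mxE.
  by apply: eq_bigr => k _; congr (_ * _); rewrite [RHS]mxE // !mxE.
have := mxrank_Frobenius M P M^T.
rewrite isoM mxrank0 addn0 -(mxrank_tr (P *m _)) trmx_mul trmxK polar_mx_sym.
rewrite mul_col_mx addnn => /leq_trans/(_ r3).
by case: (\rank _) => [|[|]].
Qed.

Lemma meval_delta Q i : Q \is 2.-homog ->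
  Q.@[(delta_mx 0 i : 'rV_N) ord0] = Q@_(U_(i) + U_(i)).
Proof.
move=> Qh; rewrite meval_upper // (bigD1 i) //= (bigD1 i) //= !big1 ?addr0.
- by rewrite !mxE leqnn !eqxx !mulr1.
- move=> j ji; rewrite big1 // => k _.
  by rewrite !mxE (negPf ji) mul0r mulr0.
- by move=> j ji; rewrite !mxE (negPf ji) !mulr0.
Qed.

(** The coefficients of squares are assumed zero separately: the polar matrix only records their
    doubles, which are lost in characteristic 2. *)
Lemma polar_mx_eq0 Q : Q \is 2.-homog -> polar_mx Q = 0 ->
  (forall i, Q@_(U_(i) + U_(i)) = 0) -> Q = 0.
Proof.
move=> Qh P0 Qii; apply/mpolyP => m; rewrite mcoeff0.
have [m2|m2] := eqVneq (mdeg m) 2%N; last exact: dhomog_nemf_coeff Qh m2.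
have [i [j ->]] := mdeg2P m2; have [<-//|ij] := eqVneq i j.
by move/matrixP/(_ i j): P0; rewrite !mxE (negPf ij).
Qed.

End PolarForm.

(** * Quadrics of rank at most 3 through the Segre variety *)

Section Segre.
Local Open Scope ring_scope.
Variables (K : fieldType) (l : nat) (n : 'I_l -> nat).
Local Notation T := (segre_index n).
Local Notation N := #|T|.
Local Notation point := (forall i : 'I_l, 'rV[K]_(n i).+1).
Implicit Types (u v : point) (Q : {mpoly K[N]}).

Definition component (k : 'I_N) (i : 'I_l) : 'I_(n i).+1 := (enum_val k : T) i.

Lemma component_inj k k' : (forall i, component k i = component k' i) -> k = k'.
Proof. by move=> e; apply: enum_val_inj; apply/ffunP. Qed.

Definition upd u v (i : 'I_l) : point := fun j => if j == i then u j else v j.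

Lemma segre_mapE u k : segre_map u ord0 k = \prod_i u i ord0 (component k i).
Proof. by rewrite mxE. Qed.

Lemma eq_segre_map u v : (forall i, u i = v i) -> segre_map u = segre_map v.
Proof.
move=> uv; apply/rowP=> k; rewrite !segre_mapE.
by apply: eq_bigr => i _; rewrite uv.
Qed.

(** Linearity in the factor [i]: the line through two pure tensors that differ in one factor
    consists of pure tensors. *)
Lemma segre_map_upd u v w i a b : (forall j, w j = a *: u j + b *: v j) ->
  segre_map (upd w u i) = a *: segre_map u + b *: segre_map (upd v u i).
Proof.
move=> we; apply/rowP=> k; rewrite [RHS]mxE ![(_ *: segre_map _) _ _]mxE.
rewrite !segre_mapE !(bigD1 (P := predT) i) //=.
have updE w' : \prod_(j | j != i) upd w' u i j ord0 (component k j)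
    = \prod_(j | j != i) u j ord0 (component k j).
  by apply: eq_bigr => j /negPf ji; rewrite /upd ji.
by rewrite !updE /upd !eqxx we !mxE mulrDl !mulrA.
Qed.

Lemma segre_map_delta k :
  segre_map (fun i => delta_mx 0 (component k i)) = delta_mx 0 k :> 'rV[K]_N.
Proof.
apply/rowP=> k'; rewrite segre_mapE mxE eqxx /=.
have [->|kk'] := eqVneq k' k.
  by rewrite big1 // => i _; rewrite mxE !eqxx.
have /existsP[i ii] : [exists i, component k' i != component k i].
  apply: contraNT kk' => /existsPn e; apply/eqP/component_inj => i.
  by apply/eqP; have := e i; rewrite negbK.
by rewrite (bigD1 i) //= mxE (negPf ii) mul0r.
Qed.

(** A tuple with a zero factor maps to the zero vector, where a quadratic form vanishes. Such tuples
    occur among the linear combinations taken in one factor. *)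
Lemma segre_vanish Q : Q \is 2.-homog ->
  (forall x, segre K n x -> Q.@[x ord0] = 0) ->
  forall u, Q.@[segre_map u ord0] = 0.
Proof.
move=> Qh Q0 u; have [/forallP u0|] := boolP [forall i, u i != 0].
  by apply: Q0; exists u.
rewrite negb_forall => /existsP[i]; rewrite negbK => /eqP ui.
have s0 k : segre_map u ord0 k = 0.
  by rewrite segre_mapE (bigD1 i) //= ui mxE mul0r.
rewrite meval_upper // big1 // => j _; rewrite big1 // => k _.
by rewrite s0 mul0r mulr0.
Qed.

Section LowRank.
Variable Q : {mpoly K[N]}.
Hypotheses (Qh : Q \is 2.-homog) (r3 : (qf_rank Q <= 3)%N).
Hypothesis Q0 : forall x, segre K n x -> Q.@[x ord0] = 0.
Local Notation phi u := (segre_map u *m polar_mx Q).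

Lemma phi_upd_parallel u v i : parallel (phi u) (phi (upd v u i)).
Proof.
apply: isotropic_pencil_parallel => //; first by rewrite -qf_rank_polar.
move=> a b; rewrite -(segre_map_upd (w := fun j => a *: u j + b *: v j)) //.
exact: segre_vanish.
Qed.

(** Induction on the number of factors in which [u] and [v] differ. Exchanging their [i]-th factors
    gives two intermediate tuples, each linked to both [u] and [v]; a nonzero image of either one
    allows transitivity. *)
Lemma phi_parallel u v : parallel (phi u) (phi v).
Proof.
have [m] := ubnP #|[pred j | u j != v j]|.
elim: m u v => // m IHm u v; rewrite ltnS => card_m.
have [/existsP[i uvi]|/existsPn uv] := boolP [exists j, u j != v j]; last first.
  rewrite (@eq_segre_map u v) => [a b|j]; first by rewrite mulrC.
  by apply/eqP; have := uv j; rewrite negbK.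
(* Such [u1] and [v1] agree at [i] and differ elsewhere only where [u] and [v] do, so the count
   drops. *)
have IH u1 v1 : (forall j, j != i -> u1 j = u j) ->
    (forall j, j != i -> v1 j = v j) -> u1 i = v1 i ->
  parallel (phi u1) (phi v1).
  move=> u1E v1E e; apply: IHm; apply: leq_trans card_m; apply: proper_card.
  apply/properP; split; last by exists i; rewrite !inE // e eqxx.
  apply/subsetP=> j; rewrite !inE; apply: contraNneq => uvj.
  by have [->|ji] := eqVneq j i; rewrite ?e // u1E // v1E // uvj.
have updN w w' j : j != i -> upd w w' i j = w' j by rewrite /upd => /negPf->.
have updi w w' : upd w w' i i = w i by rewrite /upd eqxx.
have uu' := phi_upd_parallel u v i; have vv' := phi_upd_parallel v u i.
have uv' : parallel (phi u) (phi (upd u v i)).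
  by apply: IH => [j|j|]; rewrite ?updi //; apply: updN.
have u'v : parallel (phi (upd v u i)) (phi v).
  by apply: IH => [j|j|]; rewrite ?updi //; apply: updN.
have [v'0|v'0] := eqVneq (phi (upd u v i)) 0; last first.
  exact: parallel_trans v'0 uv' (parallel_sym vv').
have [u'0|u'0] := eqVneq (phi (upd v u i)) 0; last first.
  exact: parallel_trans u'0 uu' u'v.
(* phi u and phi v do not change when the i-th factor becomes u i + v i. *)
pose w : point := fun j => u j + v j.
have wu : phi (upd w u i) = phi u.
  rewrite (@segre_map_upd u v w i 1 1) => [|j]; last by rewrite !scale1r.
  by rewrite !scale1r mulmxDl u'0 addr0.
have wv : phi (upd w v i) = phi v.
  rewrite (@segre_map_upd v u w i 1 1) => [|j]; last by rewrite !scale1r addrC.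
  by rewrite !scale1r mulmxDl v'0 addr0.
rewrite -wu -wv; apply: IH => [j|j|]; try exact: updN.
by rewrite !updi.
Qed.

Lemma low_rank_eq0 : Q = 0.
Proof.
have Qii i : Q@_(U_(i) + U_(i)) = 0.
  by rewrite -meval_delta // -segre_map_delta segre_vanish.
apply: polar_mx_eq0 => //; apply/matrixP=> i j; rewrite [RHS]mxE.
(* Rows [i] and [j] of the polar matrix are parallel; the minor on columns [i], [j] and the zero
   diagonal make the square of the [(i, j)] entry vanish. *)
have := @phi_parallel (fun s => delta_mx 0 (component i s))
  (fun s => delta_mx 0 (component j s)) i j.
rewrite !segre_map_delta -!rowE ![row _ _ _ _]mxE -{4}polar_mx_sym.
rewrite [polar_mx Q i i]mxE Qii mul0rn mul0r [(_^T) _ _]mxE => /esym/eqP.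
by rewrite mulf_eq0 orbb => /eqP.
Qed.

End LowRank.

End Segre.

(** * Uniqueness of base [D] digits, and polynomials vanishing off 0 *)

Lemma digits_inj (D M : nat) (c c' : 'I_M -> nat) :
  (forall r, c r < D) -> (forall r, c' r < D) ->
  \sum_r c r * D ^ r = \sum_r c' r * D ^ r -> c =1 c'.
Proof.
elim: M c c' => [|M IHM] c c' cD c'D; first by move=> _ [].
have split0 (a : 'I_M.+1 -> nat) :
    \sum_r a r * D ^ r = (\sum_r a (lift ord0 r) * D ^ r) * D + a ord0.
  rewrite big_ord_recl expn0 muln1 addnC big_distrl; congr (_ + _).
  by apply: eq_bigr => r _; rewrite expnS mulnCA mulnC.
rewrite !split0 => e.
(* Reduction modulo [D] isolates the lowest digit; the others follow by induction after division by
   [D]. *)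
have e0 : c ord0 = c' ord0.
  by move/(congr1 (modn^~ D)): e; rewrite !modnMDl !modn_small.
have D0 : 0 < D by apply: leq_ltn_trans (cD ord0).
have {}e : \sum_r c (lift ord0 r) * D ^ r = \sum_r c' (lift ord0 r) * D ^ r.
  by move/eqP: e; rewrite e0 eqn_add2r eqn_pmul2r // => /eqP.
move=> r; case: (unliftP ord0 r) => [r' ->|-> //].
exact: (IHM (fun s => c (lift ord0 s)) (fun s => c' (lift ord0 s))).
Qed.

Lemma digits_inj_fin (G : finType) (D : nat) (c c' : G -> nat) :
  (forall g, c g < D) -> (forall g, c' g < D) ->
  \sum_g c g * D ^ enum_rank g = \sum_g c' g * D ^ enum_rank g -> c =1 c'.
Proof.
move=> cD c'D.
have reindexE a : \sum_g a g * D ^ enum_rank g =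
    \sum_(r < #|G|) a (enum_val r) * D ^ r.
  rewrite [RHS](reindex (@enum_rank G)); last exact/onW_bij/enum_rank_bij.
  by apply: eq_bigr => g _; rewrite enum_rankK.
rewrite !reindexE => /digits_inj e g; rewrite -(enum_rankK g).
exact: e.
Qed.

Lemma closed_poly_eq0 (K : closedFieldType) (p : {poly K}) :
  (forall t, t != 0 -> p.[t] = 0)%R -> p = 0%R.
Proof.
(* Otherwise p X + 1 is a nonconstant polynomial equal to 1 everywhere. *)
move=> p0; apply/eqP; apply: contraT => pn0.
have /closed_rootP[t] : size (p * 'X + 1)%R != 1.
  by rewrite -polyC1 size_MXaddC (negPf pn0) eqSS size_poly_eq0.
rewrite rootE !hornerE; have [->|/p0->] := eqVneq t 0%R.
  by rewrite mulr0 add0r oner_eq0.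
by rewrite mul0r add0r oner_eq0.
Qed.

(** * Segre binomials and congruence of monomials modulo them *)

Section Binomials.
Local Open Scope ring_scope.
Variables (K : fieldType) (l : nat) (n : 'I_l -> nat).
Local Notation T := (segre_index n).
Local Notation N := #|T|.
Implicit Types (b c k : 'I_N) (i : 'I_l) (m : 'X_{1..N}).

Definition swap b c i : 'I_N :=
  enum_rank ([ffun j => if j == i then component c j else component b j] : T).

Lemma component_swap b c i j :
  component (swap b c i) j = if j == i then component c j else component b j.
Proof. by rewrite /component enum_rankK ffunE. Qed.

(** A 2 x 2 minor of the flattening that separates the factor [i] from the others. *)
Definition segre_binomial b c i : {mpoly K[N]} :=
  'X_b * 'X_c - 'X_(swap b c i) * 'X_(swap c b i).

Definition is_segre_binomial (p : {mpoly K[N]}) : Prop :=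
  exists b c i, p = segre_binomial b c i.

Lemma segre_binomial_homog b c i : segre_binomial b c i \is 2.-homog.
Proof. by rewrite rpredB // -mpolyXD dhomogX /= mdegD !mdeg1. Qed.

Lemma segre_binomial_vanish b c i x :
  segre K n x -> (segre_binomial b c i).@[x ord0] = 0.
Proof.
move=> [u [_ ->]]; rewrite mevalB !mevalM !mevalXU !segre_mapE -!big_split /=.
apply/eqP; rewrite subr_eq0; apply/eqP; apply: eq_bigr => j _.
by rewrite !component_swap; case: (j == i) => //; rewrite mulrC.
Qed.

(** The polar matrix of each monomial is a sum of two matrix units, and the rank is subadditive. *)
Lemma segre_binomial_rank b c i : (qf_rank (segre_binomial b c i) <= 4)%N.
Proof.
have polarX (s t : 'I_N) :
    polar_mx ('X_s * 'X_t : {mpoly K[N]}) = delta_mx s t + delta_mx t s.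
  apply/matrixP=> p q; rewrite !mxE -mpolyXD mcoeffX mnm2_eq.
  rewrite ![p == _]eq_sym ![q == _]eq_sym.
  have [<-|pq] := eqVneq p q.
    by rewrite (andbC (t == p)) orbb -mulr2n.
  rewrite mulr1n (andbC (t == p)).
  case: (boolP ((s == p) && (t == q))) => [/andP[/eqP-> _]|_];
    last by rewrite add0r.
  by rewrite (negPf pq) addr0.
rewrite qf_rank_polar (_ : polar_mx _ = polar_mx ('X_b * 'X_c) -
  polar_mx ('X_(swap b c i) * 'X_(swap c b i))); last first.
  by apply/matrixP=> p q; rewrite !mxE mcoeffB mulrnBl.
rewrite !polarX; apply: leq_trans (mxrank_add _ _) _; rewrite mxrank_opp.
rewrite (@leq_add _ _ 2 2) // (leq_trans (mxrank_add _ _)) // !mxrank_delta //.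
Qed.

(** The exponent of the coordinate [a] of the factor [i] after the Segre parametrization is
    substituted into [m]; these numbers form the multidegree. *)
Definition cnt m i (a : 'I_(n i).+1) : nat :=
  (\sum_(k | component k i == a) m k)%N.
Arguments cnt m i a : clear implicits.

Lemma cntD m m' i a : cnt (m + m')%MM i a = (cnt m i a + cnt m' i a)%N.
Proof. by rewrite -big_split; apply: eq_bigr => k _; rewrite mnmDE. Qed.

Lemma cntU k i a : cnt U_(k)%MM i a = (component k i == a).
Proof.
rewrite /cnt; case: (altP (component k i =P a)) => [ka|/negPf ka].
  rewrite (bigD1 k) ?ka //= mnm1E eqxx big1 // => j /andP[_ jk].
  by rewrite mnm1E eq_sym (negPf jk).
rewrite big1 // => j /eqP ja; rewrite mnm1E; case: eqP => // kj.
by rewrite -ja kj eqxx in ka.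
Qed.

Lemma cnt_swap b c i j a :
  ((component (swap b c i) j == a) + (component (swap c b i) j == a) =
  (component b j == a) + (component c j == a))%N.
Proof. by rewrite !component_swap; case: (j == i) => //; rewrite addnC. Qed.

Local Notation J := (ideal_gen is_segre_binomial).

(** Induction on the number of entries in which [b] differs from [k]: each binomial move corrects
    one entry of [b] and preserves all counts. *)
Lemma extract_variable k b m :
  (forall i, 0 < cnt (U_(b) + m)%MM i (component k i))%N ->
  exists m', J ('X_[U_(b) + m] - 'X_[U_(k) + m']) /\
    forall i a, cnt (U_(b) + m)%MM i a = cnt (U_(k) + m')%MM i a.
Proof.
have [d] := ubnP #|[pred i | component b i != component k i]|.
elim: d b m => // d IHd b m; rewrite ltnS => card_d pos.
have [/existsP[i bki]|/existsPn bk] :=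
    boolP [exists i, component b i != component k i]; last first.
  exists m; have -> : b = k.
    by apply: component_inj => i; apply/eqP; have := bk i; rewrite negbK.
  by rewrite subrr; split=> //; apply: ideal_gen0.
(* The count at [component k i] is positive and [b] does not contribute to it, so some variable [c]
   of [m] does. *)
have /existsP[c /andP[/eqP cki mc]] :
    [exists c, (component c i == component k i) && (m c != 0)]%N.
  apply: contraLR (pos i) => /existsPn m0.
  rewrite cntD cntU (negPf bki) -eqn0Ngt /cnt big1 // => c cki.
  by have := m0 c; rewrite cki negbK => /eqP.
have [m2 mE] : exists m2, m = (U_(c) + m2)%MM.
  by exists (m - U_(c))%MM; rewrite addmC submK // lep1mP.
pose b' := swap b c i; pose c' := swap c b i.
have cntE j a : cnt (U_(b) + m)%MM j a = cnt (U_(b') + (U_(c') + m2))%MM j a.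
  by rewrite mE !cntD !cntU !addnA cnt_swap.
have [|j|m' [Jm' cnt']] := IHd b' (U_(c') + m2)%MM.
- apply: leq_trans card_d; apply: proper_card; apply/properP; split.
    apply/subsetP=> j; rewrite !inE component_swap.
    by have [->|//] := eqVneq j i; rewrite cki eqxx.
  by exists i; rewrite inE // negbK component_swap eqxx cki.
- by rewrite -cntE.
exists m'; split=> [|j a]; last by rewrite cntE cnt'.
rewrite -(subrK 'X_[U_(b') + (U_(c') + m2)] 'X_[_]) -addrA.
apply: ideal_genD => //.
rewrite mE !mpolyXD !mulrA -mulrBl mulrC; apply: ideal_genMl.
by apply: ideal_gen_mem; exists b, c, i.
Qed.

(** Induction on the degree: a variable of [m] is extracted from [m'] and cancelled. The factor [i0]
    ensures that zero counts force the trivial monomial. *)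
Lemma same_cnt_congr (i0 : 'I_l) m m' :
  (forall i a, cnt m i a = cnt m' i a) -> J ('X_[m] - 'X_[m']).
Proof.
have leq_cnt m1 k i : (m1 k <= cnt m1 i (component k i))%N.
  by rewrite /cnt (bigD1 k) //= leq_addr.
have mnmP0 m1 : m1 != 0%MM -> exists k m2, m1 = (U_(k) + m2)%MM.
  move=> m10; have [k mk] : exists k, m1 k != 0%N.
    apply/existsP; apply: contraNT m10 => /existsPn m0; apply/eqP/mnmP=> k.
    by rewrite mnm0E; apply/eqP; have := m0 k; rewrite negbK.
  by exists k, (m1 - U_(k))%MM; rewrite addmC submK // lep1mP.
have cnt_0 i a : cnt 0%MM i a = 0%N.
  by rewrite /cnt big1 // => k _; rewrite mnm0E.
have [d] := ubnP (mdeg m).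
elim: d m m' => // d IHd m m'; rewrite ltnS => md cntE.
have [m0|/mnmP0[k [m1 mE]]] := eqVneq m 0%MM.
  rewrite (_ : m' = m) ?subrr; first exact: ideal_gen0.
  apply/mnmP=> k; rewrite m0 mnm0E; apply/eqP; rewrite -leqn0.
  by apply: leq_trans (leq_cnt m' k i0) _; rewrite -cntE m0 cnt_0.
have pos i : (0 < cnt m' i (component k i))%N.
  by rewrite -cntE mE cntD cntU eqxx.
have [b [m'1 m'E]] : exists b m'1, m' = (U_(b) + m'1)%MM.
  by apply: mnmP0; apply: contraL (pos i0) => /eqP->; rewrite cnt_0.
have [|m2 [Jm2 cnt2]] := @extract_variable k b m'1; first by rewrite -m'E.
rewrite -(subrK 'X_[U_(k) + m2] 'X_[m]) -addrA; apply: ideal_genD; last first.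
  by rewrite -opprB -mulN1r m'E; apply: ideal_genMl.
rewrite mE !mpolyXD -mulrBr; apply: ideal_genMl; apply: IHd.
  by apply: leq_trans md; rewrite mE mdegD mdeg1.
move=> i a; apply/eqP; rewrite -(eqn_add2l (cnt U_(k)%MM i a)) -!cntD -cnt2.
by rewrite -mE -m'E cntE.
Qed.

End Binomials.
Arguments cnt {l n} m i a.

(** * The binomials generate all polynomials vanishing on the Segre variety *)

Section Generation.
Local Open Scope ring_scope.
Variables (K : closedFieldType) (l : nat) (n : 'I_l -> nat).
Local Notation N := #|segre_index n|.
Implicit Types (f : {mpoly K[N]}) (m : 'X_{1..N}).

(** Coordinates of all factors are gathered in one finite type, whose ranks serve as digit
    positions. *)
Definition index_pair i (a : 'I_(n i).+1) : {i : 'I_l & 'I_(n i).+1} :=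
  Tagged _ a.

Definition weight (D : nat) m : nat :=
  (\sum_k m k * \sum_i D ^ enum_rank (index_pair (component k i)))%N.

(** Double counting: the weight has the counts as coefficients in base [D]. They are true digits
    once [D] exceeds the degree of [m]. *)
Lemma weight_cnt D m : weight D m =
  (\sum_(g : {i : 'I_l & 'I_(n i).+1})
     cnt m (tag g) (tagged g) * D ^ enum_rank g)%N.
Proof.
rewrite /weight; under eq_bigr do rewrite big_distrr /=.
rewrite exchange_big /=.
under eq_bigr => i _ do
  rewrite (partition_big (fun k => component k i) predT) //=.
rewrite sig_big_dep /=; apply: eq_bigr => -[i a] _ /=.
by rewrite /cnt big_distrl; apply: eq_bigr => k /eqP->.
Qed.

Lemma cnt_le_mdeg m i a : (cnt m i a <= mdeg m)%N.
Proof.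
by rewrite mdegE /cnt [leqRHS](bigID (fun k => component k i == a)) leq_addr.
Qed.

Lemma weight_inj_cnt D m m' : (mdeg m < D)%N -> (mdeg m' < D)%N ->
  weight D m = weight D m' -> forall i a, cnt m i a = cnt m' i a.
Proof.
move=> mD m'D; rewrite !weight_cnt => e i a.
have := digits_inj_fin _ _ e (index_pair a); apply=> g /=.
  exact: leq_ltn_trans (cnt_le_mdeg _ _) mD.
exact: leq_ltn_trans (cnt_le_mdeg _ _) m'D.
Qed.

(* Substituting u_i(a) = t ^ D ^ (rank of (i, a)) turns every monomial into
   a power of t which determines its multidegree. *)
Lemma weight_sum_eq0 f D w :
  (forall x, segre K n x -> f.@[x ord0] = 0) ->
  \sum_(m <- msupp f | weight D m == w) f@_m = 0.
Proof.
move=> f0; pose p := \sum_(m <- msupp f) f@_m *: 'X^(weight D m) : {poly K}.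
have /(congr1 (coefp w)): p = 0.
  apply: closed_poly_eq0 => t t0.
  pose u i : 'rV[K]_(n i).+1 := \row_a t ^+ (D ^ enum_rank (index_pair a)).
  have /f0 : segre K n (segre_map u).
    exists u; split=> // i; apply/rV0Pn; exists ord0.
    by rewrite mxE expf_neq0.
  rewrite mevalE => <-; rewrite horner_sum; apply: eq_bigr => m _.
  rewrite hornerZ hornerXn /weight -prodrXr; congr (_ * _).
  apply: eq_bigr => k _; rewrite segre_mapE mulnC exprM; congr (_ ^+ _).
  by rewrite -prodrXr; apply: eq_bigr => i _; rewrite mxE.
rewrite /= coef0 coef_sum => p_w; rewrite -[RHS]p_w big_mkcond.
apply: eq_bigr => m _.
by rewrite coefZ coefXn eq_sym; case: eqP; rewrite ?mulr1 ?mulr0.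
Qed.

Lemma vanishing_ideal_gen (i0 : 'I_l) f :
  (forall x, segre K n x -> f.@[x ord0] = 0) ->
  ideal_gen (@is_segre_binomial K l n) f.
Proof.
(* [D] exceeds the degree of every monomial of [f], so weights determine counts; [B] bounds the
   weights, which makes grouping by weight a finite sum. *)
move=> f0; pose D := msize f; pose B := (\max_(m <- msupp f) weight D m).+1.
have ltB m : m \in msupp f -> (weight D m < B)%N.
  by move=> mf; rewrite ltnS (leq_bigmax_seq _ mf).
(* One monomial of [f] is chosen per weight. The default is harmless: the coefficients at an absent
   weight have an empty sum. *)
pose rep w := nth 0%MM (msupp f) (find (fun m => weight D m == w) (msupp f)).
have repP m : m \in msupp f ->
    rep (weight D m) \in msupp f /\ weight D (rep (weight D m)) = weight D m.
  move=> mf; have h : has (fun m' => weight D m' == weight D m) (msupp f).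
    by apply/hasP; exists m.
  by split; [rewrite mem_nth // -has_find | apply/eqP/(nth_find 0%MM h)].
have rep0 :
    \sum_(m <- msupp f) f@_m *: 'X_[rep (weight D m)] = 0 :> {mpoly K[N]}.
  transitivity (\sum_(w < B) (\sum_(m <- msupp f | weight D m == w) f@_m)
      *: 'X_[rep w] : {mpoly K[N]}); last first.
    by apply: big1 => w _; rewrite weight_sum_eq0 // scale0r.
  under [RHS]eq_bigr => w _ do rewrite scaler_suml big_mkcond /=.
  rewrite exchange_big /= [LHS]big_seq [RHS]big_seq; apply: eq_bigr => m mf.
  rewrite (bigD1 (Ordinal (ltB _ mf))) //= eqxx big1 ?addr0 // => w.
  by rewrite -val_eqE /= eq_sym => /negPf->.
rewrite (_ : f = \sum_(m <- msupp f) f@_m *: ('X_[m] - 'X_[rep (weight D m)])).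
  apply: ideal_gen_sum => m mf; rewrite -mul_mpolyC.
  have [rf wr] := repP m mf; apply: ideal_genMl.
  apply: (same_cnt_congr _ i0).
  by apply: (@weight_inj_cnt D); rewrite ?wr //; apply: msize_mdeg_lt.
under eq_bigr do rewrite scalerBr.
by rewrite sumrB rep0 subr0 -mpolyE.
Qed.

End Generation.

(** * The homogeneous ideal of the Segre variety and its rank index *)

Section SegreIdeal.
Local Open Scope ring_scope.
Variables (K : closedFieldType) (l : nat) (n : 'I_l -> nat).
Local Notation N := #|segre_index n|.
Local Notation I := (homogeneous_ideal (segre K n)).

Lemma homogeneous_ideal_vanish f x : I f -> segre K n x -> f.@[x ord0] = 0.
Proof.
move=> [r [c [g [g0 ->]]]] Xx; rewrite raddf_sum big1 // => i _.
by rewrite /= mevalM (proj2 (g0 i)) ?mulr0.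
Qed.

Lemma segre_low_rank_eq0 (Q : {mpoly K[N]}) :
  I Q -> Q \is 2.-homog -> (qf_rank Q <= 3)%N -> Q = 0.
Proof.
move=> IQ Qh r3; apply: low_rank_eq0 => // x; exact: homogeneous_ideal_vanish.
Qed.

Lemma segre_binomial_ideal b c i : I (segre_binomial K b c i).
Proof.
apply: ideal_gen_mem; split; first by exists 2%N; apply: segre_binomial_homog.
move=> x; exact: segre_binomial_vanish.
Qed.

Lemma segre_ideal_gen (i0 : 'I_l) f :
  I f <-> ideal_gen (@is_segre_binomial K l n) f.
Proof.
split; apply: ideal_gen_sub => q.
  by case=> _ /(vanishing_ideal_gen i0).
case=> b [c [i ->]]; exact: segre_binomial_ideal.
Qed.

(** This serves the lower bound, as the zero ideal has rank index 0. The indices [b] and [c] differ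
    in every entry, so after an exchange at [i0] the entries at [i0] and [i1] show that the monomial
    has changed. *)
Lemma segre_ideal_neq0 :
  (1 < l)%N -> (forall i, 0 < n i)%N -> exists2 f, I f & f != 0.
Proof.
move=> hl hn; pose i0 := Ordinal (ltnW hl); pose i1 := Ordinal hl.
pose b : 'I_N := enum_rank ([ffun=> ord0] : segre_index n).
pose c : 'I_N := enum_rank ([ffun=> ord_max] : segre_index n).
have bE i : component b i = ord0 by rewrite /component enum_rankK ffunE.
have cE i : component c i = ord_max by rewrite /component enum_rankK ffunE.
have bc i : component b i != component c i.
  by rewrite bE cE -val_eqE /= eq_sym -lt0n.
exists (segre_binomial K b c i0); first exact: segre_binomial_ideal.
apply/eqP=> /mpolyP/(_ (U_(b) + U_(c))%MM)/eqP.
rewrite mcoeff0 mcoeffB -!mpolyXD !mcoeffX eqxx mnm2_eq.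
have /negPf-> : swap b c i0 != b.
  apply/eqP=> /(congr1 (fun k => component k i0)); rewrite component_swap eqxx.
  by apply/eqP; rewrite eq_sym bc.
have /negPf-> : swap b c i0 != c.
  apply/eqP=> /(congr1 (fun k => component k i1)); rewrite component_swap.
  by apply/eqP; rewrite bc.
by rewrite subr0 oner_eq0.
Qed.

End SegreIdeal.

Theorem theorem4p1 (K : closedFieldType) (l : nat) (n : 'I_l -> nat)
    (hl : 2 <= l) (hn : forall i : 'I_l, 1 <= n i) :
  is_rank_index (segre K n) 4 /\
  (forall Q : {mpoly K[#|segre_index n|]},
     homogeneous_ideal (segre K n) Q -> Q \is 2.-homog -> qf_rank Q <> 3).
Proof.
split; [split|].
- exists (@is_segre_binomial K l n); split; last first.
    exact: segre_ideal_gen (Ordinal (ltnW hl)).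
  move=> Q [b [c [i ->]]]; split; first exact: segre_binomial_homog.
  exact: segre_binomial_rank.
(* Generators of rank below 4 would all be zero, against the nonzero element of the ideal. *)
- move=> j [S [Sq IS]]; rewrite leqNgt; apply/negP => j3.
  have [f /IS[r [c [g [Sg ->]]]] /eqP] := segre_ideal_neq0 K hl hn; apply.
  apply: big1 => i _; have [gh gr] := Sq _ (Sg i).
  rewrite (segre_low_rank_eq0 _ gh) ?GRing.mulr0 //; last exact: leq_trans gr _.
  by apply/IS/ideal_gen_mem.
- move=> Q IQ Qh r3.
  have Q0 : Q = 0%R by apply: segre_low_rank_eq0; rewrite ?r3.
  suff : qf_rank Q = 0 by rewrite r3.
  rewrite qf_rank_polar Q0 (_ : polar_mx _ = 0%R) ?mxrank0 //.
  by apply/matrixP=> i j; rewrite !mxE mcoeff0 GRing.mul0rn.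
Qed.
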